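(* For all integers $k \geq 3$, $SP(2k+2,k) \leq 2k+3$.
   Context: A $k$-partition of a finite set $X$ is a collection of exactly $k$ pairwise disjoint non-empty subsets of $X$ (called classes) whose union is $X$. A Sperner $k$-partition system on $X$ is a set $\mathcal{P}$ of $k$-partitions of $X$ such that for any two distinct partitions $P, Q \in \mathcal{P}$, no class of $P$ is a subset of (in particular, equal to) a class of $Q$. $SP(n,k)$ denotes the maximum number of partitions in a Sperner $k$-partition system on a set of $n$ elements. *)

(* Defs.v *)
From mathcomp Require Import all_boot.

Set Implicit Arguments.
Unset Strict Implicit.
Unset Printing Implicit Defensive.

Definition kpartition (T : finType) (k : nat) (P : {set {set T}}) : bool :=
  partition P [set: T] && (#|P| == k).

(* The pair (P, Q) ranges over both orders, so classes of distinct partitions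
   are incomparable in both directions. *)
Definition sperner_system (T : finType) (k : nat)
    (S : {set {set {set T}}}) : bool :=
  [forall P in S, kpartition k P] &&
  [forall P in S, forall Q in S, (P != Q) ==>
     [forall A in P, forall B in Q, ~~ (A \subset B)]].

(* The ground set of n elements is 'I_n.  The empty system is always Sperner,
   so this is a maximum over a nonempty family. *)
Definition SP (n k : nat) : nat :=
  \max_(S : {set {set {set 'I_n}}} | sperner_system k S) #|S|.

(* Main.v *)
Require Import Defs.
From mathcomp Require Import all_boot.
From mathcomp Require Import zify.

Set Implicit Arguments.
Unset Strict Implicit.
Unset Printing Implicit Defensive.

(** Let n = 2k + 2 and suppose that a Sperner k-partition system S has at
    least 2k + 4 members.  A singleton class {x} would lie inside the class of
    x in any other member, so all classes have at least two points, and since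
    the class sizes of a member add up to only 2k + 2, at least 2k - 4 points
    of it lie in classes of size 2 ([doubleton_points]).

    Now look at a single point x.  The classes of x in the members of S, with
    x removed, form an antichain of at least 2k + 4 subsets of the other 2k + 1
    points.  The singletons of this antichain come from the members in which x
    is in a class of size 2.  If there are g of them, the rest is an antichain
    on the d = 2k + 1 - g remaining points, with at least d + 3 members.  For
    d <= 4 the Lubell-Yamamoto-Meshalkin inequality [antichain_LYM] forbids
    this, because 'C(d, d./2) < d + 3.  So d >= 5, that is, x is in a class of
    size 2 in at most 2k - 4 members ([antichain_singletons]).

    Counting the pairs (x, P) for which x is in a class of size 2 of P in both
    ways gives (2k - 4) #|S| <= (2k + 2)(2k - 4), and 2k - 4 > 0 then
    contradicts #|S| >= 2k + 4. *)

Definition antichain (T : finType) (F : {set {set T}}) : Prop :=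
  {in F &, forall A B : {set T}, A \subset B -> A = B}.

(** * Antichains of sets *)

Lemma antichainS (T : finType) (F G : {set {set T}}) :
  F \subset G -> antichain G -> antichain F.
Proof. by move=> sFG acG A B /(subsetP sFG) GA /(subsetP sFG) GB; apply: acG. Qed.

(** By induction on #|D|: unless F = {D}, deleting each point y in turn leaves
    the antichain of the members that avoid y, and a member A is counted once
    for each of the #|D| - #|A| points outside it, which is the factor that
    turns (#|D| - 1 - #|A|)`! into (#|D| - #|A|)`!. *)
Lemma antichain_LYM (T : finType) (D : {set T}) (F : {set {set T}}) :
    antichain F -> F \subset powerset D ->
  \sum_(A in F) #|A|`! * (#|D| - #|A|)`! <= #|D|`!.
Proof.
move: {2}#|D| (erefl #|D|) => n; elim: n D F => [|n IHn] D F cD acF sFD.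
all: have sub A : A \in F -> A \subset D
  by move=> FA; have := subsetP sFD A FA; rewrite powersetE.
all: have [FD | nFD] := boolP (D \in F).
1,3: rewrite (big_pred1 D) ?subnn ?fact0 ?muln1 // => A;
     apply/idP/eqP => [FA | -> //]; exact: (acF A D FA FD (sub A FA)).
- rewrite big_pred0 // => A; apply/negP => FA; case/negP: nFD.
  have D0 : D = set0 by apply/eqP; rewrite -cards_eq0 cD.
  by have := sub A FA; rewrite D0 subset0 => /eqP <-.
pose G y := [set A in F | y \notin A].
have bound y : y \in D -> \sum_(A in G y) #|A|`! * (n - #|A|)`! <= n`!.
  move=> Dy; have cDy : #|D :\ y| = n by move: (cardsD1 y D); rewrite Dy cD => -[].
  have sGF : G y \subset F by apply/subsetP=> A; rewrite inE => /andP[].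
  have := IHn (D :\ y) (G y) cDy (antichainS sGF acF); rewrite cDy; apply.
  apply/subsetP=> A; rewrite inE powersetE subsetD1 => /andP[FA ->].
  by rewrite (sub A FA).
have -> : \sum_(A in F) #|A|`! * (#|D| - #|A|)`! =
          \sum_(y in D) \sum_(A in G y) #|A|`! * (n - #|A|)`!.
  rewrite (exchange_big_dep (mem F)) /=; last by move=> y A _; rewrite inE => /andP[].
  apply: eq_bigr => A FA.
  rewrite sum_nat_const.
  have -> : #|[pred y in D | A \in G y]| = #|D :\: A|.
    by apply: eq_card => y; rewrite !inE FA andbC.
  rewrite cardsDS ?sub // cD.
  have ltAD : #|A| <= n.
    rewrite -ltnS -cD; apply: proper_card; rewrite properEneq sub // andbT.
    by apply: contraNneq nFD => <-.
  by rewrite subSn // factS mulnCA.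
by rewrite cD factS -cD -sum_nat_const; apply: leq_sum.
Qed.

(** Sperner's theorem bounds #|F| by 1, 1, 2, 3, 6 for #|D| = 0, ..., 4.  The
    bound fails for #|D| = 5, where 'C(5, 2) = 10 sets of size 2 exist. *)
Lemma card_antichain_small (T : finType) (D : {set T}) (F : {set {set T}}) :
  antichain F -> F \subset powerset D -> #|D| <= 4 -> #|F| < #|D| + 3.
Proof.
move=> acF sFD leD4; have := antichain_LYM acF sFD.
(* Equivalently 'C(n, a) < n + 3: every term of the sum in the
   Lubell-Yamamoto-Meshalkin inequality exceeds n`! / (n + 3). *)
have big_term n a : n <= 4 -> a <= n -> n`! < (n + 3) * (a`! * (n - a)`!).
  by move: n a => [|[|[|[|[|n]]]]] [|[|[|[|[|a]]]]].
move=> LYM; rewrite ltnNge; apply/negP => ge_F.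
have sum_big : #|F| * (#|D|`!).+1 <= (#|D| + 3) * \sum_(A in F) #|A|`! * (#|D| - #|A|)`!.
  rewrite -sum_nat_const big_distrr; apply: leq_sum => A FA; apply: big_term => //.
  by apply: subset_leq_card; rewrite -powersetE (subsetP sFD).
have := leq_trans (leq_mul ge_F (leqnn _)) (leq_trans sum_big (leq_mul (leqnn _) LYM)).
by rewrite leq_pmul2l ?addn3 // ltnn.
Qed.

(** Since no other member may contain a point y with [set y] in F, the
    non-singleton members form an antichain on the points that remain. *)
Lemma antichain_singletons (T : finType) (D : {set T}) (F : {set {set T}}) :
    antichain F -> F \subset powerset D -> #|D| + 3 <= #|F| ->
  #|[set A in F | #|A| == 1]| + 5 <= #|D|.
Proof.
move=> acF sFD ge_F.
pose U := [set y | [set y] \in F].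
have defS : [set A in F | #|A| == 1] = [set [set y] | y in U].
  apply/setP=> A; rewrite inE; apply/andP/imsetP => [[FA /cards1P[y defA]] | [y Uy ->]].
    by exists y => //; rewrite inE -defA.
  by rewrite cards1; move: Uy; rewrite inE.
have cS : #|[set A in F | #|A| == 1]| = #|U|.
  by rewrite defS card_imset //; apply: set1_inj.
have sUD : U \subset D.
  by apply/subsetP=> y; rewrite inE => /(subsetP sFD); rewrite powersetE sub1set.
pose F' := F :\: [set A in F | #|A| == 1].
have cF' : #|F'| = #|F| - #|U|.
  by rewrite -cS cardsDS //; apply/subsetP=> A; rewrite inE => /andP[].
have sF'D : F' \subset powerset (D :\: U).
  apply/subsetP=> A; rewrite !inE negb_and => /andP[nA1 FA].
  rewrite FA /= in nA1; rewrite subsetD.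
  have := subsetP sFD A FA; rewrite powersetE => -> /=.
  rewrite disjoint_subset; apply/subsetP=> y Ay; rewrite !inE; apply/negP => Fy.
  by case/negP: nA1; rewrite -(acF _ _ Fy FA) ?sub1set // cards1.
have := card_antichain_small (antichainS (subsetDl _ _) acF) sF'D.
have leUD := subset_leq_card sUD.
rewrite -/F' cS cF' cardsDS //; lia.
Qed.

(** * Points in classes of size two *)

(** A class of size a >= 2 holds a * (a == 2) such points, and
    6 <= a * (a == 2) + 2 * a, with equality for a = 2 and a = 3.  Summing over
    the k classes, whose sizes add up to 2k + 2, leaves 6k - 2(2k + 2) points. *)
Lemma doubleton_points (T : finType) (k : nat) (P : {set {set T}}) :
    #|T| = 2 * k + 2 -> kpartition k P -> {in P, forall A : {set T}, 1 < #|A|} ->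
  2 * k - 4 <= \sum_(x : T) (#|pblock P x| == 2).
Proof.
move=> cT /andP[partP /eqP cP] gt1P.
have tiP : trivIset P by case/and3P: partP.
have sumP (E : T -> nat) : \sum_(x : T) E x = \sum_(A in P) \sum_(x in A) E x.
  by rewrite -(set_partition_big _ partP); apply: eq_bigl => x; rewrite inE.
have cTP : #|T| = \sum_(A in P) #|A|.
  by rewrite -cardsT (card_partition partP).
have term A : A \in P -> 6 <= \sum_(x in A) (#|pblock P x| == 2) + 2 * #|A|.
  move=> PA; rewrite (eq_bigr (fun=> (#|A| == 2) : nat)); last first.
    by move=> x Ax; rewrite (def_pblock tiP PA Ax).
  rewrite sum_nat_const; have := gt1P A PA.
  by case: eqP => [-> // | ]; lia.
have: \sum_(A in P) 6 <= \sum_(A in P) (\sum_(x in A) (#|pblock P x| == 2) + 2 * #|A|).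
  exact: leq_sum.
rewrite sum_nat_const cP big_split /= -sumP -big_distrr /= -cTP cT.
lia.
Qed.

(** * Sperner partition systems *)

Section SpernerSystem.

Variables (T : finType) (k : nat) (S : {set {set {set T}}}).
Hypothesis spS : sperner_system k S.

Lemma sperner_kpartition P : P \in S -> kpartition k P.
Proof. by case/andP: spS => /forall_inP kS _; apply: kS. Qed.

Lemma sperner_pblock P x : P \in S -> (pblock P x \in P) && (x \in pblock P x).
Proof.
move=> /sperner_kpartition/andP[/and3P[/eqP covP _ _] _].
by rewrite pblock_mem ?mem_pblock covP inE.
Qed.

Lemma sperner_incomparable P Q A B :
  P \in S -> Q \in S -> A \in P -> B \in Q -> A \subset B -> P = Q.
Proof.
move=> SP SQ PA QB sAB; apply/eqP; apply: contraLR sAB => neqPQ.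
case/andP: spS => _ /forall_inP/(_ P SP)/forall_inP/(_ Q SQ)/implyP/(_ neqPQ).
by move=> /forall_inP/(_ A PA)/forall_inP/(_ B QB).
Qed.

Lemma sperner_class_gt1 P A : 1 < #|S| -> P \in S -> A \in P -> 1 < #|A|.
Proof.
move=> gt1S SP PA; have [Q] : exists Q, Q \in S :\ P.
  by apply/set0Pn; rewrite -card_gt0; move: (cardsD1 P S); rewrite SP; lia.
rewrite !inE => /andP[/eqP neqQP SQ].
rewrite ltnNge; apply/negP => le1A; apply: neqQP.
have /andP[/and3P[_ _ nP0] _] := sperner_kpartition SP.
have /cards1P[x defA] : #|A| == 1.
  by rewrite eqn_leq le1A card_gt0; apply: contraNneq nP0 => <-.
have /andP[QB Bx] := sperner_pblock x SQ.
by apply/esym; apply: (sperner_incomparable SP SQ PA QB); rewrite defA sub1set.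
Qed.

(** The classes of x, with x removed, form an antichain on the other points,
    so [antichain_singletons] applies. *)
Lemma sperner_doubletons_at x : #|T| + 2 <= #|S| ->
  \sum_(P in S) (#|pblock P x| == 2) + 6 <= #|T|.
Proof.
move=> geS; pose f P : {set T} := pblock P x :\ x.
have fS P Q : P \in S -> Q \in S -> f P \subset f Q -> P = Q.
  move=> SP SQ sfPQ.
  have /andP[PA Ax] := sperner_pblock x SP.
  have /andP[QB Bx] := sperner_pblock x SQ.
  apply: (sperner_incomparable SP SQ PA QB).
  by rewrite -(setD1K Ax) -(setD1K Bx) setUS.
have f_inj : {in S &, injective f}.
  by move=> P Q SP SQ eqf; apply: fS => //; rewrite eqf.
have acF : antichain (f @: S).
  by move=> _ _ /imsetP[P SP ->] /imsetP[Q SQ ->] /(fS P Q SP SQ) ->.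
have sF : f @: S \subset powerset [set~ x].
  by apply/subsetP=> _ /imsetP[P _ ->]; rewrite powersetE /f setDE subsetIr.
have cx : #|[set~ x]| = #|T| - 1 by rewrite cardsC1 subn1.
have T_gt0 : 0 < #|T| by apply/card_gt0P; exists x.
have cfS : #|f @: S| = #|S| by apply: card_in_imset.
have geF : #|[set~ x]| + 3 <= #|f @: S| by rewrite cx cfS; lia.
have := antichain_singletons acF sF geF; rewrite cx.
have -> : \sum_(P in S) (#|pblock P x| == 2) = #|[set A in f @: S | #|A| == 1]|.
  have -> : [set A in f @: S | #|A| == 1] = f @: [set P in S | #|pblock P x| == 2].
    have cf P : P \in S -> (#|f P| == 1) = (#|pblock P x| == 2).
      by move=> /(sperner_pblock x)/andP[_ Px]; rewrite [in RHS](cardsD1 x) Px.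
    apply/setP=> A; rewrite inE; apply/andP/imsetP => [[/imsetP[P SP ->]] | [P]].
      by rewrite cf // => cP; exists P; rewrite // inE SP.
    by rewrite inE => /andP[SP cP] ->; rewrite cf // imset_f.
  rewrite card_in_imset; last first.
    by move=> P Q; rewrite !inE => /andP[SP _] /andP[SQ _]; apply: f_inj.
  rewrite -sum1_card -big_mkcondr /=.
  by apply: eq_bigl => P; rewrite inE.
move: #|[set A in f @: S | _]| => g; lia.
Qed.

Lemma card_sperner_system : 2 < k -> #|T| = 2 * k + 2 -> #|S| <= 2 * k + 3.
Proof.
move=> gt2k cT; rewrite leqNgt; apply/negP => gtS.
have geS : #|T| + 2 <= #|S| by lia.
have lower : #|S| * (2 * k - 4) <= \sum_(P in S) \sum_(x : T) (#|pblock P x| == 2).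
  rewrite -sum_nat_const; apply: leq_sum => P SP.
  apply: doubleton_points (sperner_kpartition SP) _ => // A.
  by apply: sperner_class_gt1 => //; lia.
have upper : \sum_(P in S) \sum_(x : T) (#|pblock P x| == 2) <= #|T| * (2 * k - 4).
  rewrite exchange_big /= -sum_nat_const; apply: leq_sum => x _.
  rewrite -(leq_add2r 6); apply: leq_trans (sperner_doubletons_at x geS) _.
  by rewrite cT; lia.
have := leq_trans lower upper; rewrite leq_pmul2r; lia.
Qed.

End SpernerSystem.

Theorem theorem4p2 (k : nat) (hk : 3 <= k) : SP (2 * k + 2) k <= 2 * k + 3.
Proof.
apply/bigmax_leqP => S spS.
by apply: card_sperner_system spS hk _; rewrite card_ord.
Qed.
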